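(* Let $\sqsubseteq$ be either $\sqsubseteq^S_i$ or $\sqsubseteq^S_m$. For any finite set $P$ of prime numbers, there is a stochastic CA $\mathcal{U}_P$ such that for every stochastic CA $\mathcal{A}$ with $\mathscr{PF}(\mathcal{A})\subseteq P$ we have $\mathcal{A}\sqsubseteq\mathcal{U}_P$. Moreover $\mathcal{U}_P$ is a plain probabilistic CA (PCA).
   Context: A stochastic CA is $(Q,R,V,V',f)$ with $Q$ finite states, $R$ finite random symbols, $V=\{v_1,\dots,v_r\}$, $V'=\{v'_1,\dots,v'_{r'}\}$ finite subsets of $\mathbb{Z}$, $f:Q^r\times R^{r'}\to Q$; explicit global function $F(c,s)_z=f((c_{z+v_1},\dots,c_{z+v_r}),(s_{z+v'_1},\dots,s_{z+v'_{r'}}))$. It is a PCA if $V'=\{0\}$. $\mathscr{PF}(\mathcal{A})$ is the set of prime factors of $|R|$. $\nu_R$ is the uniform Bernoulli measure on $R^{\mathbb{Z}}$; the stochastic global function $S_F(c)$ is the law of $F(c,s)$ for $s\sim\nu_R$. Iterates: $F^0(c)=c$, $F^{t+1}(c,s^1,\dots,s^{t+1})=F(F^t(c,s^1,\dots,s^t),s^{t+1})$. Restriction: for injective $i:Q'\to Q$ with $Y=i(Q')^{\mathbb{Z}}$ satisfying $F(Y,R^{\mathbb{Z}})\subseteq Y$, the $i$-restriction has states $Q'$, random symbols $R$, explicit global function $I^{-1}(F(I(c),s))$ ($I$ the cellwise extension of $i$). Projection: for surjective $\pi:Q\to Q'$ with cellwise extension $\Pi$ such that $\Pi(F(c,s))=\Pi(F(c',s))$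 whenever $\Pi(c)=\Pi(c')$, the $\pi$-projection has states $Q'$, random symbols $R$, explicit global function $(c',s)\mapsto\Pi(F(c,s))$ for any $c\in\Pi^{-1}(c')$. Rescaling with $m,t\ge1,k\in\mathbb{Z}$: $\mathcal{A}^{\langle m,t,k\rangle}$ has states $Q^m$, random symbols $(R^m)^t$, explicit global function $b_m\circ\sigma_k\circ F^t(b_m^{-1}(c),b_m^{-1}(s^1),\dots,b_m^{-1}(s^t))$ where $s^i_j=(s_j)_i$, $\sigma_k(c)_z=c_{z+k}$, $b_m(c)_z=(c_{mz},\dots,c_{mz+m-1})$. $\mathcal{A}_1\sqsubseteq^S_i\mathcal{A}_2$ (resp. $\sqsubseteq^S_m$) iff there are $m_1,m_2,t_1,t_2,k_1,k_2$ such that $\mathcal{A}_1^{\langle m_1,t_1,k_1\rangle}$ has the same stochastic global function as some $i$-restriction (resp. some $\pi$-projection of some $i$-restriction) of $\mathcal{A}_2^{\langle m_2,t_2,k_2\rangle}$. *)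

(* Defs.v *)
From mathcomp Require Import all_boot all_order all_algebra.
Unset Printing Implicit Defensive.
Import Order.TTheory GRing.Theory Num.Theory.

(* A stochastic CA (Q,R,V,V',f).  V = {V i | i < nb}, V' = {Vr j | j < nbr},
   listed without repetition (injectivity); R is nonempty so that the uniform
   Bernoulli measure nu_R exists. *)
Record SCA := {
  st : finType;
  rs : finType;
  nb : nat;  V : 'I_nb -> int;  V_inj : injective V;
  nbr : nat; Vr : 'I_nbr -> int; Vr_inj : injective Vr;
  rule : ('I_nb -> st) -> ('I_nbr -> rs) -> st;
  rs_nonempty : (0 < #|rs|)%N
}.

Definition config (T : Type) := int -> T.
Definition EGF (Q R : Type) := config Q -> config R -> config Q.

Definition gf (A : SCA) : EGF (st A) (rs A) :=
  fun c s z => @rule A (fun i => c (z + @V A i)%R) (fun j => s (z + @Vr A j)%R).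

Fixpoint iterG {Q R} (G : EGF Q R) (n : nat) (c : config Q) (ss : nat -> config R)
  : config Q :=
  match n with 0 => c | n'.+1 => G (iterG G n' c ss) (ss n') end.

Definition shift {T} (k : int) (c : config T) : config T := fun z => c (z + k)%R.

Definition blk {T} (m' : nat) (c : config T) : config {ffun 'I_m'.+1 -> T} :=
  fun z => [ffun i : 'I_m'.+1 => c ((m'.+1)%:Z * z + (nat_of_ord i)%:Z)%R].
Definition unblk {T} (m' : nat) (d : config {ffun 'I_m'.+1 -> T}) : config T :=
  fun z => d (z %/ (m'.+1)%:Z)%Z (inord (absz (z %% (m'.+1)%:Z)%Z)).

Definition rescale {Q R : Type} (G : EGF Q R) (m' t' : nat) (k : int)
  : EGF {ffun 'I_m'.+1 -> Q} {ffun 'I_t'.+1 -> {ffun 'I_m'.+1 -> R}} :=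
  fun c s => @blk _ m' (shift k (iterG G t'.+1 (@unblk _ m' c)
                      (fun n => @unblk _ m' (fun j => s j (inord n))))).

Definition invariant {Q' Q R : Type} (i : Q' -> Q) (G : EGF Q R) :=
  forall (c : config Q') (s : config R) z, exists q', G (fun y => i (c y)) s z = i q'.
Definition restr {Q' Q : finType} {R : Type} (i : Q' -> Q) (G : EGF Q R) : EGF Q' R :=
  fun c s z => match [pick q' | i q' == G (fun y => i (c y)) s z] with
               | Some q' => q' | None => c z end.

(* projection along pi : Q -> Q', sec a section of pi used to pick a preimage *)
Definition proj_compat {Q Q' R : Type} (pi : Q -> Q') (G : EGF Q R) :=
  forall (c c' : config Q) (s : config R), (forall z, pi (c z) = pi (c' z)) ->
    forall z, pi (G c s z) = pi (G c' s z).
Definition proj {Q Q' R : Type} (pi : Q -> Q') (sec : Q' -> Q) (G : EGF Q R) : EGF Q' R :=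
  fun c s z => pi (G (fun y => sec (c y)) s z).

(* Laws: S_G(c) is the law of G(c,s), s ~ nu_R.  Two laws on Q^Z coincide iff
   they agree on all cylinders {x | forall z in W, x z = p z}.  The nu_R-measure
   of an event depending only on coordinates in [-N,N] is a finite count. *)
Definition ext {R : Type} (N : nat) (g : {ffun 'I_(2*N).+1 -> R}) : config R :=
  fun z => if ((- (N%:Z) <= z) && (z <= N%:Z))%R
           then g (inord (absz (z + N%:Z)%R)) else g ord0.
Definition cyl_event {Q : eqType} {R : Type} (G : EGF Q R) (c : config Q)
  (W : seq int) (p : config Q) (s : config R) : bool :=
  all (fun z => G c s z == p z) W.
Definition depends_within {R : Type} (E : config R -> bool) (N : nat) :=
  forall s s' : config R, (forall z, ((- (N%:Z) <= z) && (z <= N%:Z))%R -> s z = s' z) ->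
    E s = E s'.
Definition cyl_count {R : finType} (E : config R -> bool) (N : nat) : nat :=
  #|[pred g : {ffun 'I_(2*N).+1 -> R} | E (@ext _ N g)]|.
Definition same_law {Q R1 R2 : finType} (G1 : EGF Q R1) (G2 : EGF Q R2) :=
  forall (c : config Q) (W : seq int) (p : config Q), exists N1 N2 : nat,
    [/\ depends_within (cyl_event G1 c W p) N1,
        depends_within (cyl_event G2 c W p) N2 &
        (cyl_count (cyl_event G1 c W p) N1 * #|R2| ^ (2*N2).+1
         = cyl_count (cyl_event G2 c W p) N2 * #|R1| ^ (2*N1).+1)%N].

Definition sim_i (A1 A2 : SCA) :=
  exists (m1' m2' t1' t2' : nat) (k1 k2 : int)
         (i : {ffun 'I_m1'.+1 -> st A1} -> {ffun 'I_m2'.+1 -> st A2}),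
    [/\ injective i, invariant i (rescale (gf A2) m2' t2' k2) &
        same_law (rescale (gf A1) m1' t1' k1) (restr i (rescale (gf A2) m2' t2' k2))].

Definition sim_m (A1 A2 : SCA) :=
  exists (m1' m2' t1' t2' : nat) (k1 k2 : int) (Q' : finType)
         (i : Q' -> {ffun 'I_m2'.+1 -> st A2})
         (pi : Q' -> {ffun 'I_m1'.+1 -> st A1}) (sec : {ffun 'I_m1'.+1 -> st A1} -> Q'),
    [/\ injective i, invariant i (rescale (gf A2) m2' t2' k2),
        cancel sec pi (* hence pi surjective *),
        proj_compat pi (restr i (rescale (gf A2) m2' t2' k2)) &
        same_law (rescale (gf A1) m1' t1' k1)
                 (proj pi sec (restr i (rescale (gf A2) m2' t2' k2)))].

Definition PF_sub (A : SCA) (P : seq nat) :=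
  forall p, prime p -> (p %| #|rs A|)%N -> p \in P.

Definition isPCA (A : SCA) := nbr A = 1%N /\ forall j, @Vr A j = 0%R.

(* Main.v *)
(** The universal automaton has three layers.  A data layer stays put, an agent
    layer moves one cell to the right and an instruction layer one cell to the
    left at each step; an instruction acts where an agent stands on a datum.
    Encoded configurations are periodic in the last two layers, with period
    the block length.  Since agents and instructions move in opposite
    directions, each agent of a block meets each datum of a block with its own
    instruction, so a fixed instruction set can run an arbitrary table.

    In one macro-step every agent crosses the data areas of three consecutive
    blocks.  The first agent fills the data of the first one with random
    symbols.  Each other agent carries one row (w1, w2) of the transition table:
    it compares w1 with the first block, w2 with the second, and, if both agree,
    overwrites the third with the image of (w1, w2).  All comparisons are over
    before any writing starts, so the update is made in place, up to a shift by
    two blocks.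

    A stochastic CA of radius d, grouped in blocks of 2d+1 cells and shifted by d,
    has each new block determined by two neighbouring blocks.  As |R| divides a
    power of the product of the primes of P, its random symbols are images, with
    fibres of equal size, of words over an alphabet with that product as size. *)
From Stdlib Require Import FunctionalExtensionality.
Require Import Defs.
From mathcomp Require Import all_boot all_order all_algebra zify.
Import Order.TTheory GRing.Theory Num.Theory.
Set Implicit Arguments. Unset Strict Implicit. Unset Printing Implicit Defensive.

(** * Coordinates of an integer relative to blocks *)

Lemma int_block (m' : nat) (x : int) :
  exists z y, (y < m'.+1)%N /\ x = (m'.+1%:Z * z + y%:Z)%R.
Proof.
exists (x %/ m'.+1%:Z)%Z, `|(x %% m'.+1%:Z)%Z|%N.
have := divz_eq x m'.+1; have := modz_ge0 x (isT : m'.+1%:Z != 0)%R.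
have := ltz_pmod x (isT : 0 < m'.+1%:Z)%R; lia.
Qed.

Lemma divz_block (m' : nat) (z : int) (y : nat) : (y < m'.+1)%N ->
  ((m'.+1%:Z * z + y%:Z)%R %/ m'.+1%:Z)%Z = z.
Proof. by move=> ly; rewrite mulrC divzMDl // divz_small ?addr0 //; lia. Qed.

Lemma modz_block (m' : nat) (z : int) (y : nat) : (y < m'.+1)%N ->
  `|((m'.+1%:Z * z + y%:Z)%R %% m'.+1%:Z)%Z|%N = y.
Proof. by move=> ly; rewrite mulrC modzMDl modz_small //; lia. Qed.

Lemma unblk_block (T : Type) (m' : nat) (d : config {ffun 'I_m'.+1 -> T}) z y :
  (y < m'.+1)%N -> @unblk _ m' d (m'.+1%:Z * z + y%:Z)%R = d z (inord y).
Proof. by move=> ly; rewrite /unblk divz_block ?modz_block. Qed.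

Lemma divmodnMDl (a b q : nat) : (b < q)%N ->
  ((a * q + b) %/ q = a)%N /\ ((a * q + b) %% q = b)%N.
Proof. by move=> lb; rewrite divnMDl ?modnMDl ?divn_small ?modn_small ?addn0 //; lia. Qed.

(** * The universal automaton and its space-time diagram *)

Section Machine.
Variable p' : nat.
Notation Rnd := 'I_p'.+1.
Notation Dat := (bool * Rnd)%type.
Notation Agt := ('I_3 * bool)%type.
Notation dinstr := {ffun Dat * Agt * Rnd -> Dat}.
Notation ainstr := {ffun Dat * Agt -> Agt}.

Definition ucell : finType := ((dinstr * ainstr) * option Dat * option Agt)%type.

Definition run_data (q : ucell) (r : Rnd) : option Dat :=
  if q is (f, Some d, Some a) then Some (f.1 (d, a, r)) else q.1.2.
Definition run_agent (q : ucell) : option Agt :=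
  if q is (f, Some d, Some a) then Some (f.2 (d, a)) else q.2.

Definition uoff (k : 'I_3) : int := (k%:Z - 1)%R.
Definition uoff0 (k : 'I_1) : int := 0%R.
Lemma uoff_inj : injective uoff.
Proof. by move=> i j; rewrite /uoff => h; apply: val_inj => /=; lia. Qed.
Lemma uoff0_inj : injective uoff0.
Proof. by move=> i j _; rewrite !ord1. Qed.

Definition urule (n : 'I_3 -> ucell) (r : 'I_1 -> Rnd) : ucell :=
  ((n (inord 2)).1.1, run_data (n (inord 1)) (r ord0), run_agent (n (inord 0))).

Lemma Rnd_gt0 : (0 < #|{: Rnd}|)%N. Proof. by rewrite card_ord. Qed.

Definition U : SCA :=
  {| st := ucell; rs := Rnd; V_inj := uoff_inj; Vr_inj := uoff0_inj;
     rule := urule; rs_nonempty := Rnd_gt0 |}.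

Lemma gfUE (c : config ucell) (s : config Rnd) x :
  gf U c s x = ((c (x + 1)%R).1.1, run_data (c x) (s x), run_agent (c (x - 1)%R)).
Proof.
rewrite /gf /= /urule /uoff /uoff0 !inordK //.
have -> : (x + (2%N%:Z - 1) = x + 1)%R by lia.
have -> : (x + (1%N%:Z - 1) = x)%R by lia.
by have -> : (x + (0%N%:Z - 1) = x - 1)%R by lia.
Qed.

Section Run.
Variables (l' N' : nat).
Notation l := l'.+1.
Notation lam := (2 * l)%N.
Notation N := N'.+1.
Definition bsize' : nat := (lam * N).-1.
Notation m := bsize'.+1.
Let mE : m = (lam * N)%N. Proof. by rewrite /bsize'; lia. Qed.

(* Agent number [n] of block [z] is the one starting [lam * n] cells to the left
   of it; [dat z j n] and [car z n j] are the states of the datum [j] of block [z]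
   and of that agent just before they meet, at time [lam * n + j]. *)
Variables (prog : nat -> dinstr * ainstr) (init : Agt).
Variables (dat : int -> nat -> nat -> Dat) (car : int -> nat -> nat -> Agt).
Variable (ss : nat -> config Rnd).

(** The last index of [dat] counts the agents that have passed [y] before time [t]; [minn y l]
    freezes an agent once it leaves the data area. If [t < y], the agent started in this block
    beyond the data. *)
Definition cell_at (t : nat) (z : int) (y : nat) : ucell :=
  (prog ((y + t) %% m)%N,
   if (y < l)%N then Some (dat z y (t %/ lam + (y < t %% lam))%N) else None,
   if y == t %[mod lam] then
     Some (if (t < y)%N then init else car z ((t - y) %/ lam)%N (minn y l))
   else None).

Definition conf (t : nat) : config ucell :=
  fun x => cell_at t (x %/ m%:Z)%Z `|(x %% m%:Z)%Z|%N.

Lemma confE t z y : (y < m)%N -> conf t (m%:Z * z + y%:Z)%R = cell_at t z y.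
Proof. by move=> ly; rewrite /conf divz_block ?modz_block. Qed.

Hypothesis dat_step : forall z n j, (n < 3 * N)%N -> (j < l)%N ->
  dat z j n.+1 = (prog (lam * (n %% N) + 2 * j)%N).1
    (dat z j n, car z n j, ss (lam * n + j)%N (m%:Z * z + j%:Z)%R).
Hypothesis car_step : forall z n j, (n < 3 * N)%N -> (j < l)%N ->
  car z n j.+1 = (prog (lam * (n %% N) + 2 * j)%N).2 (dat z j n, car z n j).
Hypothesis car_init : forall z n, (n < N)%N -> car z n 0 = init.
Hypothesis car_next : forall z n, (n <= 2 * N)%N ->
  car z (n + N)%N 0 = car (z - 1)%R n l.

(** Instructions and agents approach at relative speed two, hence [2 * j]; the spacing [lam = 2 * l]
    keeps the addresses of distinct rows apart. *)
Let addr_prog n j : (j < l)%N ->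
  ((j + (lam * n + j)) %% m = lam * (n %% N) + 2 * j)%N.
Proof.
move=> lj; rewrite mE {1}(divn_eq n N).
have -> : (j + (lam * (n %/ N * N + n %% N) + j) =
  (n %/ N) * (lam * N) + (lam * (n %% N) + 2 * j))%N by nia.
have ln : (n %% N < N)%N by rewrite ltn_mod.
by rewrite modnMDl modn_small //; nia.
Qed.

Lemma cell_data t z y : (t < 3 * m)%N -> (y < m)%N ->
  run_data (cell_at t z y) (ss t (m%:Z * z + y%:Z)%R) = (cell_at t.+1 z y).1.2.
Proof.
move=> lt ly; rewrite /run_data /cell_at /=.
case: ifP => ly'; last by [].
have lb : (t %% lam < lam)%N by rewrite ltn_mod.
have ylam : (y %% lam = y)%N by rewrite modn_small //; lia.
have tE := divn_eq t lam; set a := (t %/ lam)%N in tE *; set b := (t %% lam)%N in tE lb *.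
(* The count grows exactly when an agent stands at [y]; [b.+1 = lam] is the case where the remainder
   wraps round. *)
have cnt : (t.+1 %/ lam + (y < t.+1 %% lam) = a + (y < b) + (y == b))%N.
  have [e|ne] := eqVneq b.+1 lam.
    have [-> ->] : (t.+1 %/ lam = a.+1 /\ t.+1 %% lam = 0)%N.
      have -> : t.+1 = (a.+1 * lam + 0)%N by nia.
      exact: divmodnMDl.
    by case: eqP; lia.
  have [-> ->] : (t.+1 %/ lam = a /\ t.+1 %% lam = b.+1)%N.
    have -> : t.+1 = (a * lam + b.+1)%N by lia.
    by apply: divmodnMDl; lia.
  by case: eqP; lia.
rewrite ylam cnt; case: eqP => [e|_]; last by rewrite addn0.
rewrite -e ltnn addn0 addn1.
have tE' : t = (lam * a + y)%N by lia.
have -> : (t < y)%N = false by lia.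
have -> : ((t - y) %/ lam = a)%N by rewrite tE' addnK mulnC mulnK.
have -> : minn y l = y by lia.
rewrite dat_step //; last by nia.
by rewrite tE' addr_prog // -tE'.
Qed.

Lemma cell_agent t z y : (t < 3 * m)%N -> (y.+1 < m)%N ->
  run_agent (cell_at t z y) = (cell_at t.+1 z y.+1).2.
Proof.
move=> lt ly; rewrite /run_agent /cell_at /=.
have -> : (y.+1 == t.+1 %[mod lam]) = (y == t %[mod lam]).
  by rewrite -addn1 -(addn1 t) eqn_modDr.
rewrite subSS [(t.+1 < y.+1)%N]ltnS.
case: (ltnP y l) => ly'; last first.
  by have -> : minn y.+1 l = l by lia.

case: ifP => // /eqP e; congr Some.
have lb : (t %% lam < lam)%N by rewrite ltn_mod.
have ylam : (y %% lam = y)%N by rewrite modn_small //; lia.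
have tE := divn_eq t lam; rewrite -e ylam in tE *.
set a := (t %/ lam)%N in tE *.
have tE' : t = (lam * a + y)%N by lia.
have -> : (t < y)%N = false by lia.
have -> : ((t - y) %/ lam = a)%N by rewrite tE' addnK mulnC mulnK.
have -> : minn y.+1 l = y.+1 by lia.
rewrite car_step //; last by nia.
by rewrite ltnn addn0 tE' addr_prog.
Qed.

(** Crossing a border renumbers agent [n] of block [z - 1] as agent [n + N] of block [z]. If
    [t < bsize'], it has met no datum yet. *)
Lemma cell_agent_next t z : (t < 3 * m)%N ->
  run_agent (cell_at t (z - 1)%R m.-1) = (cell_at t.+1 z 0).2.
Proof.
move=> lt; rewrite /run_agent /cell_at /=.
have -> : (bsize' < l)%N = false by nia.
have -> : (bsize' == t %[mod lam]) = (0 == t.+1 %[mod lam]).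
  by rewrite -(eqn_modDr 1) !addn1 mE modnMr mod0n.
case: ifP => // /eqP e; congr Some; rewrite subn0 min0n.
have -> : minn bsize' l = l by nia.
have tE := divn_eq t.+1 lam; rewrite -e mod0n addn0 in tE.
set a := (t.+1 %/ lam)%N in tE *.
case: (ltnP t bsize') => lt'; first by rewrite car_init //; nia.
have aN : (N <= a)%N by nia.
rewrite -(subnK aN) car_next; last by nia.
congr car; have -> : (t - bsize' = (a - N) * lam)%N by nia.
by rewrite mulnK.
Qed.

Lemma iter_conf t : (t <= 3 * m)%N -> forall x, iterG (gf U) t (conf 0) ss x = conf t x.
Proof.
elim: t => [//|t IH] lt x.
change (iterG (gf U) t.+1 (conf 0) ss x) with
  (gf U (iterG (gf U) t (conf 0) ss) (ss t) x).
have E : iterG (gf U) t (conf 0) ss = conf t.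
  by apply: functional_extensionality; apply: IH; apply: ltnW.
rewrite E gfUE; have [z [y [ly ->]]] := int_block bsize' x.
rewrite (confE _ _ ly) cell_data // [RHS]confE //.
rewrite [RHS]surjective_pairing [(cell_at t.+1 z y).1]surjective_pairing.
congr (_, _, _).
- have [e|ne] := eqVneq y.+1 m.
    have -> : (m%:Z * z + y%:Z + 1 = m%:Z * (z + 1) + 0%N%:Z)%R by lia.
    rewrite confE // /= add0n -addSnnS e modnDl; congr (prog _).
  have -> : (m%:Z * z + y%:Z + 1 = m%:Z * z + y.+1%:Z)%R by lia.
  by rewrite confE /= ?addSnnS //; lia.
- case: y ly => [|y] ly.
    have -> : (m%:Z * z + 0%N%:Z - 1 = m%:Z * (z - 1) + m.-1%:Z)%R by lia.
    by rewrite confE // cell_agent_next.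
  have -> : (m%:Z * z + y.+1%:Z - 1 = m%:Z * z + y%:Z)%R by lia.
  by rewrite confE ?cell_agent //; lia.
Qed.

End Run.
End Machine.

(** * Uniform laws under maps with equal fibres *)

Lemma card_fibers_ffun (I R1 R2 : finType) (th : R2 -> R1) (k : nat) :
  (forall a, #|[pred x | th x == a]| = k) ->
  forall g1 : {ffun I -> R1},
    #|[pred g : {ffun I -> R2} | [ffun x => th (g x)] == g1]| = (k ^ #|I|)%N.
Proof.
move=> hk g1; transitivity #|family (fun x => [pred y | th y == g1 x])|.
  apply: eq_card => g; rewrite !inE; apply/eqP/familyP => [<- x|h].
    by rewrite inE ffunE.
  by apply/ffunP => x; rewrite ffunE; apply/eqP; apply: h.
rewrite card_family -(prod_nat_const I) /image_mem foldrE big_map big_enum /=.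
by apply: eq_bigr => x _; apply: hk.
Qed.

Lemma cyl_count_comp (R1 R2 : finType) (th : R2 -> R1) (k N : nat) (E : config R1 -> bool) :
  (forall a, #|[pred x | th x == a]| = k) ->
  cyl_count (fun s : config R2 => E (fun z => th (s z))) N =
    (cyl_count E N * k ^ (2 * N).+1)%N.
Proof.
move=> hk; pose F (g : {ffun 'I_(2 * N).+1 -> R2}) := [ffun x => th (g x)].
have extF g : (fun z => th (@ext _ N g z)) = @ext _ N (F g).
  by apply: functional_extensionality => z; rewrite /ext; case: ifP; rewrite ffunE.
rewrite /cyl_count -sum1_card (partition_big F (fun g1 => E (@ext _ N g1))) /=; last first.
  by move=> g; rewrite inE extF.
rewrite -sum_nat_const; apply: eq_bigr => g1 hg1.
rewrite -[RHS](_ : (k ^ #|{: 'I_(2 * N).+1}|)%N = _); last by rewrite card_ord.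
rewrite -(card_fibers_ffun hk g1) -sum1_card; apply: eq_bigl => g.
rewrite !inE -/(F g); case: (F g =P g1) => [e|_]; last by rewrite andbF.
by rewrite extF e hg1.
Qed.

Lemma card_fibers_prod (R1 R2 : finType) (th : R2 -> R1) (k : nat) :
  (forall a, #|[pred x | th x == a]| = k) -> #|R2| = (k * #|R1|)%N.
Proof.
move=> hk; rewrite -sum1_card (partition_big th xpredT) //= mulnC -sum_nat_const.
by apply: eq_bigr => a _; rewrite -(hk a) -sum1_card.
Qed.

(** A map with equal fibres sends the uniform measure to the uniform measure; [N] bounds all
    coordinates that the cylinder can read. *)
Lemma same_law_factor (Q R1 R2 : finType) (G1 : EGF Q R1) (G2 : EGF Q R2)
    (th : R2 -> R1) (k r : nat) :
  (forall a, #|[pred x | th x == a]| = k) ->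
  (forall c s z, G2 c s z = G1 c (fun u => th (s u)) z) ->
  (forall c s s' z, (forall u : int, (`|u - z| <= r)%N -> s u = s' u) ->
     G1 c s z = G1 c s' z) ->
  same_law G1 G2.
Proof.
move=> hk hG loc c W p; pose N := (r + \sum_(z <- W) `|z|)%N.
have dep : depends_within (cyl_event G1 c W p) N.
  move=> s s' ss'; apply: eq_in_all => z zW; congr (_ == _); apply: loc => u ur.
  apply: ss'; have : (`|z| <= \sum_(z <- W) `|z|)%N.
    by rewrite (big_rem z) //= leq_addr.
  by rewrite /N; set M := (\sum_(_ <- _) _)%N; lia.
have ev : cyl_event G2 c W p = fun s => cyl_event G1 c W p (fun u => th (s u)).
  by apply: functional_extensionality => s; apply: eq_all => z; rewrite hG.
exists N, N; split=> //.
  by rewrite ev => s s' h; apply: dep => z hz; rewrite h.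
by rewrite ev (cyl_count_comp _ _ hk) (card_fibers_prod hk) expnMn mulnA.
Qed.

(** Each [mv b] injects any fibre into the fibre over [b], so no fibre is larger than another. *)
Lemma equal_fibers (R1 R2 : finType) (th : R2 -> R1) (mv : R1 -> R2 -> R2) :
  (forall b x, th (mv b x) = b) ->
  (forall a b, {in [pred x | th x == a] &, injective (mv b)}) ->
  exists k, forall a, #|[pred x | th x == a]| = k.
Proof.
move=> hmv inj.
have le a b : (#|[pred x | th x == a]| <= #|[pred x | th x == b]|)%N.
  rewrite -(card_in_image (inj a b)); apply/subset_leq_card/subsetP => x.
  by case/imageP => y _ ->; rewrite inE hmv.
case: (pickP {: R1}) => [a0 _|R10].
  by exists #|[pred x | th x == a0]| => a; apply/eqP; rewrite eqn_leq !le.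
by exists 0 => a; have := R10 a.
Qed.

(** The exponent of a prime in [n] is smaller than [n]. *)
Lemma dvd_exp_of_primes (n q : nat) : (0 < n)%N -> 
  (forall p, prime p -> (p %| n)%N -> (p %| q)%N) -> (n %| q ^ n)%N.
Proof.
move=> n0 h; apply/dvdn_partP => // p; rewrite mem_primes => /and3P[pp _ pn].
rewrite p_part; apply: (@dvdn_trans (p ^ n)).
  by apply: dvdn_exp2l; rewrite ltnW // ltn_logl.
by apply: dvdn_exp2r; apply: h.
Qed.

(** * Grouping a stochastic CA into a rule on two neighbouring blocks *)

Definition two (T : Type) (x0 x1 : T) : config T := fun z => if z == 0%R then x0 else x1.

Lemma unblk_two (T : Type) (m' : nat) (c : config {ffun 'I_m'.+1 -> T}) (z w : int) :
  (0 <= w < (2 * m'.+1)%N%:Z)%R ->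
  @unblk _ m' c (m'.+1%:Z * z + w)%R = @unblk _ m' (two (c z) (c (z + 1)%R)) w.
Proof.
move=> hw; case: (ltrP w m'.+1%:Z%R) => lw.
  have -> : w = (m'.+1%:Z * 0 + `|w|%N%:Z)%R by lia.
  rewrite mulr0 add0r -[X in _ = unblk _ _ X]add0r -[in RHS](mulr0 m'.+1%:Z%R).
  by rewrite !unblk_block /two //; lia.
have -> : w = (m'.+1%:Z * 1 + `|w - m'.+1%:Z|%N%:Z)%R by lia.
rewrite [RHS]unblk_block; last by lia.
rewrite addrA -mulrDr unblk_block //; lia.
Qed.

Section Grouped.
Variables (A : SCA) (d : nat).
Notation m1' := (2 * d)%N.
Notation X := {ffun 'I_m1'.+1 -> st A}.
Notation S := {ffun 'I_1 -> {ffun 'I_m1'.+1 -> rs A}}.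
Hypothesis Vd : forall i, (`|@V A i| <= d)%N.
Hypothesis Vrd : forall i, (`|@Vr A i| <= d)%N.

Definition grouped : EGF X S := rescale (gf A) m1' 0 d%:Z%R.
Definition phi (x0 x1 : X) (r0 r1 : S) : X := grouped (two x0 x1) (two r0 r1) 0%R.

(** The offsets read, [i + d + v] with [0 <= i <= 2 * d] and [|v| <= d], stay in [[0, 4 * d]], hence
    inside two blocks of [2 * d + 1] cells. *)
Lemma groupedE c s z : grouped c s z = phi (c z) (c (z + 1)%R) (s z) (s (z + 1)%R).
Proof.
apply/ffunP => i; rewrite !ffunE /shift /= /gf.
have li := ltn_ord i.
have E T (e : config {ffun 'I_m1'.+1 -> T}) (v : int) : (`|v| <= d)%N ->
    unblk m1' e (m1'.+1%:Z * z + i%:Z + d%:Z + v)%R =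
    unblk m1' (two (e z) (e (z + 1)%R)) (m1'.+1%:Z * 0 + i%:Z + d%:Z + v)%R.
  move=> hv; rewrite mulr0 add0r -!addrA unblk_two //; lia.
congr (rule A _ _); apply: functional_extensionality => a; rewrite E //.
by congr (unblk _ _ _); apply: functional_extensionality => j; rewrite /two; case: eqP.
Qed.

Lemma grouped_local c s s' z : (forall u : int, (`|u - z| <= 1)%N -> s u = s' u) ->
  grouped c s z = grouped c s' z.
Proof. by move=> h; rewrite !groupedE !h //; lia. Qed.
End Grouped.

(** * The program of a two-neighbour rule *)

Section Simulation.
Variables (p' l' : nat) (X S : finType).
Notation Rnd := 'I_p'.+1.
Notation Dat := (bool * Rnd)%type.
Notation Agt := ('I_3 * bool)%type.
Notation l := l'.+1.
Notation lam := (2 * l)%N.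
Notation W := {ffun 'I_l -> Dat}.
Notation N' := #|{: W * W}|.
Notation N := N'.+1.
Notation m := (bsize' l' N').+1.

Variables (phi : X -> X -> S -> S -> X) (tau : {ffun 'I_l -> Rnd} -> S).
Hypothesis Xl : (#|X| <= l)%N.

(** One-hot code of the rank of [q]. *)
Definition bit (q : X) (j : nat) : bool := enum_rank q == j :> nat.
Definition dec (w : W) : option X := [pick q | [forall j, (w j).1 == bit q j]].
Definition samp (w : W) : S := tau [ffun j => (w j).2].
(** Every pair of words has a row, so words that encode no state get a value too. The random slot is
    reset to [ord0], as in [enc]. *)
Definition out (w1 w2 : W) (j : nat) : Dat :=
  (if (dec w1, dec w2) is (Some q1, Some q2)
   then bit (phi q1 q2 (samp w1) (samp w2)) j else false, ord0).

(* Agent [0] samples the random symbols and has no row. *)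
Definition row (nu : nat) : option (W * W) :=
  if nu is nu'.+1 then nth None [seq Some w | w <- enum {: W * W}] nu' else None.
Definition row_index (w : W * W) : nat := (index w (enum {: W * W})).+1.

(* The first component of an agent counts the data areas it has crossed in the
   current macro-step, the second one tells whether all comparisons succeeded. *)
Definition prog_data (nu j : nat) : {ffun Dat * Agt * Rnd -> Dat} :=
  [ffun u => let: (d, (ph, fl), r) := u in
    if row nu is Some (w1, w2)
    then if (ph == inord 2) && fl then out w1 w2 j else d
    else if ph == inord 0 then (d.1, r) else d].
Definition next_flag (nu j : nat) (d : Dat) (ph : 'I_3) (fl : bool) : bool :=
  if row nu is Some (w1, w2)
  then if ph == inord 0 then fl && (d == w1 (inord j))
       else if ph == inord 1 then fl && (d == w2 (inord j)) else fl
  else fl.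
(** The phase advances at the last datum; the third crossing ends by restoring [init], so that the
    agent layer is again an encoding. *)
Definition prog_agent (nu j : nat) : {ffun Dat * Agt -> Agt} :=
  [ffun u => let: (d, (ph, fl)) := u in
    if j.+1 < l then (ph, next_flag nu j d ph fl)
    else if ph == inord 2 then (inord 0, true)
    else (inord ph.+1, next_flag nu j d ph fl)]%N.
Definition prog (y : nat) :=
  (prog_data (y %/ lam) (y %% lam)./2, prog_agent (y %/ lam) (y %% lam)./2).

Definition init : Agt := (inord 0, true).

Definition enc (q : X) : {ffun 'I_m -> ucell p'} :=
  [ffun y : 'I_m => (prog y, if (y < l)%N then Some (bit q y, ord0) else None,
              if (y %% lam == 0)%N then Some init else None)].

Lemma bit_inj q q' : (forall j, (j < l)%N -> bit q j = bit q' j) -> q = q'.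
Proof.
move=> h; have lq : (enum_rank q < l)%N by apply: leq_trans Xl.
by have := h _ lq; rewrite /bit eqxx => /esym/eqP/val_inj/enum_rank_inj.
Qed.

Let lm : (l < m)%N. Proof. by rewrite /bsize'; nia. Qed.

Lemma enc_inj : injective enc.
Proof.
move=> q q' /ffunP h; apply: bit_inj => j lj.
have lj' : (j < m)%N by apply: ltn_trans lm.
by have := h (Ordinal lj'); rewrite !ffunE /= lj => -[].
Qed.

Lemma progE nu j : (j < l)%N -> prog (lam * nu + 2 * j) = (prog_data nu j, prog_agent nu j).
Proof.
move=> lj; rewrite /prog (mulnC lam).
have lj2 : (2 * j < lam)%N by lia.
have [-> ->] := divmodnMDl nu lj2.
by rewrite mul2n doubleK.
Qed.

Lemma row_index_lt w : (row_index w < N)%N.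
Proof. by rewrite ltnS cardE index_mem mem_enum. Qed.

(** Each pair occurs once in the enumeration; this singles out the one agent that overwrites a
    block. *)
Lemma row_indexP nu w : (row nu == Some w) = (nu == row_index w).
Proof.
rewrite /row_index; case: nu => [|nu] //=; rewrite eqSS.
case: (ltnP nu (size (enum {: W * W}))) => h.
  rewrite (nth_map w) //; apply/eqP/eqP => [[<-]|->].
    by rewrite index_uniq ?enum_uniq.
  by rewrite nth_index // mem_enum.
rewrite nth_default; last by rewrite size_map.
apply/esym/eqP => e.
by move: h; rewrite e leqNgt index_mem mem_enum.
Qed.

(** * The trajectory of one macro-step *)

Section Macro.
Variables (c : config X) (ss : nat -> config Rnd).

(** The data after sampling. Agent [0] meets datum [j] at time [j], so the symbols lie on a
    space-time diagonal. *)
Definition word (z : int) : W :=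
  [ffun j : 'I_l => (bit (c z) j, ss j (m%:Z * z + j%:Z)%R)].

Lemma dec_word z : dec (word z) = Some (c z).
Proof.
rewrite /dec; case: pickP => [q /forallP h|/(_ (c z))/forallP []]; last first.
  by move=> j; rewrite ffunE.
congr Some; apply: bit_inj => j lj; have := h (Ordinal lj); rewrite ffunE /=.
by move/eqP.
Qed.

(* The images are written two blocks to the right of the first word read. *)
Definition sources (z : int) : W * W := (word (z - 2)%R, word (z - 1)%R).

Definition dat (z : int) (j n : nat) : Dat :=
  if n is 0 then (bit (c z) j, ord0)
  else if (2 * N + row_index (sources z) < n)%N
  then out (sources z).1 (sources z).2 j else word z (inord j).

Definition prefix_eq (w w' : W) (j : nat) := [forall i : 'I_l, (i < j)%N ==> (w i == w' i)].

Definition flag (z : int) (n j : nat) : bool :=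
  if row (n %% N) is Some (w1, w2) then
    match (n %/ N)%N with
    | 0 => prefix_eq (word z) w1 j
    | 1 => (word (z - 1)%R == w1) && prefix_eq (word z) w2 j
    | _ => sources z == (w1, w2)
    end
  else true.

(** On reaching block [z], agent [n] has crossed [n %/ N] data areas; from [3 * N] on, its
    macro-step is over. At [j = l] the phase has already moved on. *)
Definition car (z : int) (n j : nat) : Agt :=
  if (3 * N <= n)%N then init
  else if (j < l)%N then (inord (n %/ N), flag z n j)
  else if (n %/ N == 2)%N then init else (inord (n %/ N).+1, flag z n l).

Lemma prefix_eq0 w w' : prefix_eq w w' 0.
Proof. by apply/forallP. Qed.

Lemma prefix_eq_full w w' : prefix_eq w w' l = (w == w').
Proof.
apply/forallP/eqP => [h|-> i]; last by rewrite eqxx implybT.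
by apply/ffunP => i; have := h i; rewrite ltn_ord => /eqP.
Qed.

Lemma prefix_eqS w w' j : (j < l)%N ->
  prefix_eq w w' j.+1 = prefix_eq w w' j && (w (inord j) == w' (inord j)).
Proof.
move=> lj; apply/forallP/andP => [h|[/forallP h e] i].
  split; last by have := h (inord j); rewrite inordK // ltnSn.
  by apply/forallP => i; apply/implyP => lt; have := h i; rewrite ltnS ltnW.
rewrite ltnS leq_eqVlt; case: (nat_of_ord i =P j) => [ij|_ /=]; last exact: h.
by move: e; rewrite -ij inord_val => ->.
Qed.

Lemma phase_eq a b : (a < 3)%N -> (b < 3)%N -> ((inord a : 'I_3) == inord b) = (a == b).
Proof. by move=> la lb; rewrite -val_eqE /= !inordK. Qed.

Lemma dat_word z j n : (0 < n <= 2 * N)%N -> dat z j n = word z (inord j).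
Proof. by case: n => // n /andP[_ h]; rewrite /dat ifF //; lia. Qed.

Lemma flag_init z n : (n < N)%N -> flag z n 0.
Proof.
move=> ln; rewrite /flag divn_small //.
by case: (row _) => [[w1 w2]|//]; rewrite prefix_eq0.
Qed.

Lemma car_init z n : (n < N)%N -> car z n 0 = init.
Proof.
by move=> ln; rewrite /car ifF ?flag_init ?divn_small //; lia.
Qed.

Lemma car_next z n : (n <= 2 * N)%N -> car z (n + N) 0 = car (z - 1)%R n l.
Proof.
rewrite leq_eqVlt => /orP[/eqP ->|ln].
  rewrite /car mulnK // ltnn eqxx.
  have -> : (3 * N <= 2 * N + N)%N by lia.
  by have -> : (3 * N <= 2 * N)%N = false by lia.
have ph : (n %/ N < 2)%N by rewrite ltn_divLR //; lia.
rewrite /car ltnn ifF; last by lia.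
rewrite [in RHS]ifF; last by lia.
rewrite [in RHS]ifF; last by lia.
rewrite divnDr // divnn addn1 /=; congr (_, _); rewrite /flag modnDr.
rewrite divnDr // divnn addn1.
case: (row _) => [[w1 w2]|//].
case: (n %/ N)%N ph => [|[|//]] _.
  by rewrite prefix_eq_full prefix_eq0 andbT.
by rewrite prefix_eq_full /sources xpair_eqE -addrA.
Qed.

(** An agent with a row has [n > 0], so it follows the sampling; while comparing it has [n < 2 * N],
    so it precedes all writing. Hence it reads [word z]. *)
Lemma car_step z n j : (n < 3 * N)%N -> (j < l)%N ->
  car z n j.+1 = (prog (lam * (n %% N) + 2 * j)).2 (dat z j n, car z n j).
Proof.
move=> ln lj; rewrite progE //.
have ph : (n %/ N < 3)%N by rewrite ltn_divLR.
have -> : car z n j = (inord (n %/ N), flag z n j) by rewrite /car ifF ?lj //; lia.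
rewrite ffunE.
have -> : next_flag (n %% N) j (dat z j n) (inord (n %/ N)) (flag z n j) = flag z n j.+1.
  rewrite /next_flag !phase_eq // /flag; case E: (row (n %% N)) => [[w1 w2]|//].
  have n0 : (0 < n)%N by case: (n) E => [|//]; rewrite mod0n.
  have := divn_eq n N; have lm' : (n %% N < N)%N by rewrite ltn_mod.
  by case: (n %/ N)%N ph => [|[|[|//]]] _ nE;
    rewrite ?eqxx ?prefix_eqS // ?dat_word ?andbA //; lia.
rewrite phase_eq //.
rewrite /car ifF; last by lia.
case: ifP => // lj'.
have -> : j.+1 = l by lia.
by rewrite inordK.
Qed.

Lemma row_None nu : (nu < N)%N -> row nu = None -> nu = 0.
Proof.
case: nu => [//|nu]; rewrite ltnS cardE /= => lt.
case E: (enum {: W * W}) lt => [//|w0 s] lt.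
by rewrite (nth_map w0).
Qed.

(** Only two agents change block [z]: agent [0], which samples, and agent
    [2 * N + row_index (sources z)], the only one to arrive in phase two with a matching row. *)
Lemma dat_step z n j : (n < 3 * N)%N -> (j < l)%N ->
  dat z j n.+1 = (prog (lam * (n %% N) + 2 * j)).1
    (dat z j n, car z n j, ss (lam * n + j)%N (m%:Z * z + j%:Z)%R).
Proof.
move=> ln lj; rewrite progE //.
have ph : (n %/ N < 3)%N by rewrite ltn_divLR.
have -> : car z n j = (inord (n %/ N), flag z n j) by rewrite /car ifF ?lj //; lia.
rewrite ffunE !phase_eq //.
have lt := row_index_lt (sources z); have gt : (0 < row_index (sources z))%N by [].
have nE := divn_eq n N; have lm' : (n %% N < N)%N by rewrite ltn_mod.
set ri := row_index _ in lt gt.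
case E: (row (n %% N)) => [[w1 w2]|].
  have n0 : (0 < n)%N by case: (n) E => [|//]; rewrite mod0n.
  have riE : (sources z == (w1, w2)) = (n %% N == ri)%N.
    rewrite -row_indexP E; apply/eqP/eqP => [->//|[->->]]; exact: surjective_pairing.
  have -> : ((n %/ N == 2)%N && flag z n j) = (n == 2 * N + ri)%N.
    have [e|ne] := eqVneq (n %/ N)%N 2; last by apply/esym/negbTE/eqP; nia.
    by rewrite /flag E e riE; apply/eqP/eqP; lia.
  case: eqP => [e|ne].
    have /eqP sE : sources z == (w1, w2) by rewrite riE e (divmodnMDl 2 lt).2.
    by rewrite /dat -/ri ifT ?sE //; lia.
  by rewrite /dat -/ri; case: (n) n0 ne => // n1 _ ne; congr (if _ then _ else _); lia.
(* Without a row, [n] is a multiple of [N]; phase zero then leaves only [n = 0]. *)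
have n00 := row_None lm' E; case: n ln ph lm' nE E n00 => [|n] ln ph lm' nE E n00.
  by rewrite div0n eqxx muln0 add0n /dat /= ffunE inordK.
rewrite ifF; last by apply/negbTE; nia.
by rewrite /dat -/ri; congr (if _ then _ else _); apply/idP/idP; nia.
Qed.

Lemma dat_final z j : dat z j (3 * N)%N =
  (bit (phi (c (z - 2)%R) (c (z - 1)%R)
            (samp (word (z - 2)%R)) (samp (word (z - 1)%R))) j, ord0).
Proof.
rewrite /dat -[(3 * N)%N]prednK // ifT; last by have := row_index_lt (sources z); lia.
by rewrite /out !dec_word.
Qed.

(** The duration [3 * m = 3 * N * lam] is a multiple of the periods of both moving layers, and
    [3 * N] agents pass each datum. *)
Lemma iter_enc z (y : 'I_m) :
  iterG (gf (U p')) (3 * m)%N (@unblk _ (bsize' l' N') (fun u => enc (c u))) ss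
    (m%:Z * z + y%:Z)%R =
  enc (phi (c (z - 2)%R) (c (z - 1)%R) (samp (word (z - 2)%R)) (samp (word (z - 1)%R))) y.
Proof.
have mE : m = (lam * N)%N by rewrite /bsize'; lia.
pose C := @conf p' l' N' prog init dat car.
have -> : @unblk _ (bsize' l' N') (fun u => enc (c u)) = C 0%N.
  apply: functional_extensionality => x; have [u [w [lw ->]]] := int_block (bsize' l' N') x.
  rewrite unblk_block // /C confE // ffunE inordK // /cell_at addn0 (modn_small lw) div0n mod0n ltn0.
  by congr (_, _, _); case: eqP => //= e; case: w lw e.
rewrite (iter_conf dat_step car_step car_init car_next) // confE // ffunE /cell_at.
have m3 : (3 * m = 3 * N * lam)%N by rewrite mE mulnCA mulnC mulnA.
have ly := ltn_ord y; congr (_, _, _).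
- by rewrite addnC -modnDml modnMl add0n modn_small.
- case: ifP => // ly'; rewrite -dat_final; congr (Some (dat _ _ _)).
  by rewrite m3 mulnK // modnMl addn0.
- have -> : (y == 3 * m %[mod lam]) = (y %% lam == 0)%N by rewrite m3 modnMl.
  case: eqP => // ey; congr Some.
  have -> : (3 * m < y)%N = false by lia.
  have yE := divn_eq y lam; rewrite ey addn0 in yE.
  set e := (y %/ lam)%N in yE.
  have -> : (3 * m - y = (3 * N - e) * lam)%N by nia.
  (* For [e = 0] this is agent [3 * N]; otherwise it has just left its third data area. Both are in
     state [init]. *)
  rewrite mulnK //; case: (posnP e) => e0; first by rewrite e0 subn0 /car leqnn.
  have -> : minn y l = l by nia.
  rewrite /car ifF; last by lia.
  rewrite ltnn ifT //.
  have lNe : (N - e < N)%N by lia.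
  have -> : (3 * N - e = 2 * N + (N - e))%N by nia.
  by rewrite (divmodnMDl 2 lNe).1.
Qed.

End Macro.
End Simulation.

(** * The macro-step as a rescaling, and the symbols it samples *)

Section Rescaled.
Variables (p' l' : nat).
Notation l := l'.+1.
Notation Rnd := 'I_p'.+1.
Notation N' := #|{: {ffun 'I_l -> bool * Rnd} * {ffun 'I_l -> bool * Rnd}}|.
Notation m' := (bsize' l' N').
Notation t' := (3 * m'.+1).-1.

Definition diagonal (x : {ffun 'I_t'.+1 -> {ffun 'I_m'.+1 -> Rnd}}) : {ffun 'I_l -> Rnd} :=
  [ffun j : 'I_l => x (inord j) (inord j)].

Definition set_diagonal (x : {ffun 'I_t'.+1 -> {ffun 'I_m'.+1 -> Rnd}})
    (w : {ffun 'I_l -> Rnd}) : {ffun 'I_t'.+1 -> {ffun 'I_m'.+1 -> Rnd}} :=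
  [ffun t : 'I_t'.+1 => [ffun y : 'I_m'.+1 =>
     if (t == y :> nat) && (t < l)%N then w (inord t) else x t y]].

Lemma diagonal_set x w : diagonal (set_diagonal x w) = w.
Proof.
have lm : (l <= m'.+1)%N by rewrite /bsize'; nia.
apply/ffunP => j; have lj := ltn_ord j.
by rewrite !ffunE !inordK ?eqxx ?lj ?inord_val //; lia.
Qed.

Lemma set_diagonal_inj x x' w :
  diagonal x = diagonal x' -> set_diagonal x w = set_diagonal x' w -> x = x'.
Proof.
move=> dE /ffunP sE; apply/ffunP => t; apply/ffunP => y.
have /ffunP/(_ y) := sE t; rewrite !ffunE; case: ifP => // /andP[/eqP ty lt] _.
have /ffunP/(_ (inord t)) := dE; rewrite !ffunE inordK //.
suff -> : inord t = y by rewrite inord_val.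
by apply: val_inj; rewrite /= inordK // ty.
Qed.

Variables (X S : finType).
Variables (phi : X -> X -> S -> S -> X) (tau : {ffun 'I_l -> Rnd} -> S).
Hypothesis Xl : (#|X| <= l)%N.

Lemma rescale_enc c s z :
  rescale (gf (U p')) m' t' (2 * m'.+1)%N%:Z (fun y => enc phi tau (c y)) s z =
  enc phi tau (phi (c z) (c (z + 1)%R) (tau (diagonal (s z))) (tau (diagonal (s (z + 1)%R)))).
Proof.
have lm : (l <= m'.+1)%N by rewrite /bsize'; nia.
apply/ffunP => y; rewrite [LHS]ffunE /shift.
(* The shift by two blocks cancels the displacement of the images. *)
have -> : (m'.+1%:Z * z + y%:Z + (2 * m'.+1)%N%:Z = m'.+1%:Z * (z + 2) + y%:Z)%R by lia.
pose ss (n : nat) := @unblk _ m' (fun j => s j (inord n : 'I_t'.+1)).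
have sampE u : samp tau (word l' c ss u) = tau (diagonal (s u)).
  congr tau; apply/ffunP => j; have lj := ltn_ord j.
  by rewrite !ffunE /= /ss unblk_block //; lia.
rewrite [LHS](iter_enc phi tau Xl c ss (z + 2)%R y) !sampE.
have -> : (z + 2 - 2 = z)%R by lia.
by have -> : (z + 2 - 1 = z + 1)%R by lia.
Qed.

End Rescaled.

(** * Equal fibres of the sampling map, and universality *)

Lemma card_bij (T1 T2 : finType) : #|T1| = #|T2| -> exists f : T1 -> T2, bijective f.
Proof.
move=> e; exists (fun x => enum_val (cast_ord e (enum_rank x))).
exists (fun x => enum_val (cast_ord (esym e) (enum_rank x))) => x.
  by rewrite enum_valK cast_ordK enum_rankK.
by rewrite enum_valK cast_ordKV enum_rankK.
Qed.

(** A bijection [f] splits a sampled word into an element of [S] and a position in its fibre;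
    changing only the former moves injectively between fibres. *)
Lemma diagonal_fibers (p' l' : nat) (S : finType) : (#|S| %| p'.+1 ^ l'.+1)%N ->
  exists tau : {ffun 'I_l'.+1 -> 'I_p'.+1} -> S, exists k,
    forall a, #|[pred x | tau (@diagonal p' l' x) == a]| = k.
Proof.
case/dvdnP => k kS.
have [f [g fK gK]] : exists f : {ffun 'I_l'.+1 -> 'I_p'.+1} -> 'I_k * S, bijective f.
  by apply: card_bij; rewrite card_ffun card_prod !card_ord.
exists (fun w => (f w).2).
apply: (@equal_fibers _ _ _ (fun b x => set_diagonal x (g ((f (diagonal x)).1, b)))).
  by move=> b x; rewrite diagonal_set gK.
move=> a b x x'; rewrite !inE => /eqP xa /eqP x'a E.
have d1 : (f (diagonal x)).1 = (f (diagonal x')).1.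
  have := congr1 (fun y => (f (diagonal y)).1) E.
  by rewrite !diagonal_set !gK.
apply: set_diagonal_inj; last by rewrite d1 in E; exact: E.
by apply: (can_inj fK); rewrite [LHS]surjective_pairing [RHS]surjective_pairing d1 xa x'a.
Qed.

Lemma U_universal (p' : nat) (A : SCA) :
  (forall q, prime q -> (q %| #|rs A|)%N -> (q %| p'.+1)%N) -> sim_i A (U p').
Proof.
move=> hA; pose d := (\sum_i `|@V A i| + \sum_i `|@Vr A i|)%N.
have Vd i : (`|@V A i| <= d)%N by rewrite /d (bigD1 i) //= -!addnA leq_addr.
have Vrd i : (`|@Vr A i| <= d)%N by rewrite /d addnC (bigD1 i) //= -!addnA leq_addr.
pose X : finType := {ffun 'I_(2 * d).+1 -> st A}.
pose S : finType := {ffun 'I_1 -> {ffun 'I_(2 * d).+1 -> rs A}}.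
(* The first summand makes room for the one-hot codes, the second makes [#|S|] divide the number of
   sampled words. *)
pose l' := (#|X| + #|rs A| * (2 * d).+1)%N.
have Xl : (#|X| <= l'.+1)%N by rewrite /l'; lia.
have Sl : (#|S| %| p'.+1 ^ l'.+1)%N.
  rewrite !card_ffun !card_ord expn1.
  apply: (@dvdn_trans (p'.+1 ^ (#|rs A| * (2 * d).+1))); last first.
    by apply: dvdn_exp2l; rewrite /l'; lia.
  by rewrite expnM; apply/dvdn_exp2r/dvd_exp_of_primes => //; apply: rs_nonempty.
have [tau [k fib]] := diagonal_fibers Sl.
have simE := rescale_enc (@phi A d) tau Xl.
exists (2 * d)%N, (bsize' l' #|{: {ffun 'I_l'.+1 -> bool * 'I_p'.+1} *
  {ffun 'I_l'.+1 -> bool * 'I_p'.+1}}|), 0%N, (3 * (bsize' l'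
  #|{: {ffun 'I_l'.+1 -> bool * 'I_p'.+1} * {ffun 'I_l'.+1 -> bool * 'I_p'.+1}}|).+1).-1.
exists d%:Z%R; eexists; exists (enc (@phi A d) tau); split.
- exact: enc_inj.
- by move=> c s z; eexists; apply: simE.
- apply: (same_law_factor (th := fun x => tau (diagonal x)) (k := k) (r := 1)) => //.
    move=> c s z; rewrite [RHS](groupedE Vd Vrd) /restr simE.
    set q0 := phi _ _ _ _; case: pickP => [q /eqP/(enc_inj Xl) //|/(_ q0)].
    by rewrite eqxx.
  exact: grouped_local.
Qed.

(** A restriction is its own projection along the identity. *)
Lemma sim_im (A B : SCA) : sim_i A B -> sim_m A B.
Proof.
case=> m1 [m2 [t1 [t2 [k1 [k2 [i [i_inj i_inv law]]]]]]].
exists m1, m2, t1, t2, k1, k2, {ffun 'I_m1.+1 -> st A}, i, id, id; split=> //.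
by move=> c c' s /functional_extensionality ->.
Qed.

Theorem theorem6 (P : seq nat) (HP : all prime P) :
  (exists U : SCA, isPCA U /\ forall A : SCA, PF_sub A P -> sim_i A U) /\
  (exists U : SCA, isPCA U /\ forall A : SCA, PF_sub A P -> sim_m A U).
Proof.
pose p' := (\prod_(q <- P) q).-1.
have pE : p'.+1 = \prod_(q <- P) q.
  rewrite prednK // big_seq prodn_cond_gt0 // => q qP.
  by apply: prime_gt0; apply: (allP HP).
have sim A : PF_sub A P -> sim_i A (U p').
  move=> hA; apply: U_universal => q pq qA.
  by rewrite pE (big_rem q) ?dvdn_mulr //; apply: hA.
by split; exists (U p'); split=> // A /sim => // /sim_im.
Qed.
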